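(* Let $M=M_1\times_fM_T$ be a $(q+m)$-dimensional warped product proper skew semi-invariant submanifold of order $1$ of a locally product Riemannian manifold $(\bar M,g,F)$ of dimension $2q+m$, where $\dim M_1=q$ and $\dim M_T=m$. Then the invariant distribution $\mathcal D^T$ of $M_T$ is integrable.
   Context: All objects are smooth. A locally product Riemannian manifold $(\bar M,g,F)$ is a Riemannian manifold $(\bar M,g)$ with Levi-Civita connection $\overline\nabla$ and a $(1,1)$-tensor field $F$ such that $F^2=I$, $F\neq\pm I$, $g(F\bar U,F\bar V)=g(\bar U,\bar V)$ and $(\overline\nabla_{\bar U}F)\bar V=0$ for all $\bar U,\bar V\in T\bar M$. Let $M$ be an isometrically immersed submanifold of $\bar M$. For $U\in TM$ write $FU=TU+NU$ with $TU$ tangent and $NU$ normal to $M$. Put $\mathcal D^\bot_p=\ker T_p$ (the anti-invariant distribution) and $\mathcal D^T_p=\ker N_p$ (the invariant distribution: $F\mathcal D^T=\mathcal D^T$). $M$ is a skew semi-invariant submanifold of order $1$ if there is a constant $\lambda_1=\cos\theta\in(0,1)$ such that $\lambda_1^2$ is an eigenvalue of $T_p^2$ at each $p\in M$, $T_pM=\mathcal D^\bot_p\oplus\mathcal D^T_p\oplus\mathcal D^\theta_p$ orthogonally with $\mathcal D^\theta_p=\ker(T^2-\cos^2\theta\, I)_p$ (the slant distribution), and the dimensions of the three distributions do not depend on $p$. It is proper if $\mathcal D^\bot\ne\{0\}$ and $\mathcal D^T\neq\{0\}$. The warped product $M_1\times_fM_2$ of Riemannian manifolds $(M_1,g_1),(M_2,g_2)$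 with positive function $f$ on $M_1$ is $M_1\times M_2$ with metric $g_1+f^2g_2$. A warped product proper skew semi-invariant submanifold of order $1$, $M=M_1\times_fM_T$, is a submanifold of $\bar M$ which, with its induced metric, is a warped product where $M_1$ is a hemi-slant submanifold tangent to $\mathcal D^\bot\oplus\mathcal D^\theta$ (with $\mathcal D^\bot\neq\{0\}$) and $M_T$ is an invariant submanifold tangent to $\mathcal D^T$; thus $TM=\mathcal D^\theta\oplus\mathcal D^\bot\oplus\mathcal D^T$. *)

(* Defs.v *)
From HB Require Import structures.
From mathcomp Require Import all_boot all_order all_algebra.
From mathcomp Require Import all_classical all_reals all_analysis.

Set Implicit Arguments.
Unset Strict Implicit.
Unset Printing Implicit Defensive.

Import Order.TTheory GRing.Theory Num.Theory.
Import numFieldNormedType.Exports.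

Local Open Scope classical_set_scope.
Local Open Scope ring_scope.

Section SmoothOn.
Context {R : realType}.

Fixpoint Ck_on (k : nat) n (A : set 'rV[R]_n) (f : 'rV[R]_n -> R) : Prop :=
  (forall x, A x -> {for x, continuous f}) /\
  match k with
  | 0 => True
  | k'.+1 => forall v, (forall x, A x -> derivable f x v) /\
                       Ck_on k' A (fun x => 'D_v f x)
  end.

(* Meaningful for open [A] only. *)
Definition smooth_on n (A : set 'rV[R]_n) (f : 'rV[R]_n -> R) :=
  forall k, Ck_on k A f.

Lemma smooth_onS n (A B : set 'rV[R]_n) f :
  A `<=` B -> smooth_on B f -> smooth_on A f.
Proof.
move=> AB fB k; have {fB} := fB k.
elim: k f => [|k IH] f [cf df]; split=> //; first by move=> x /AB /cf.
  by move=> x /AB /cf.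
move=> v; have [d Cd] := df v; split; first by move=> x /AB /d.
exact: IH.
Qed.

Lemma smooth_on_linear n n' (L : {linear 'rV[R]_n -> 'rV[R]_n'})
    (A : set 'rV[R]_n') f :
  continuous L -> smooth_on A f -> smooth_on (L @^-1` A) (f \o L).
Proof.
move=> cL fA k; have {fA} := fA k.
have dE g x v : (fun h : R => h^-1 *: (((g \o L) \o shift x) (h *: v) - (g \o L) x))
              = (fun h => h^-1 *: ((g \o shift (L x)) (h *: L v) - g (L x))).
  by apply/funext => h /=; rewrite linearP.
elim: k f => [|k IH] f [cf df]; split=> //=.
- by move=> x Ax; apply: continuous_comp; [exact: cL | exact: cf].
- by move=> x Ax; apply: continuous_comp; [exact: cL | exact: cf].
move=> v; have [d Cd] := df (L v); split.
  by move=> x Ax; rewrite /derivable dE; exact: d.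
have -> : (fun x => 'D_v (f \o L) x) = (fun x => 'D_(L v) f x) \o L.
  by apply/funext => x /=; rewrite /derive dE.
exact: IH.
Qed.

Lemma rV_continuous (T : topologicalType) n (f : T -> 'rV[R]_n) x :
  (forall i, continuous_at x (fun y => f y ord0 i)) ->
  {for x, continuous f}.
Proof.
move=> cf B [P nP PB].
have /(filter_forall) : forall i, \forall y \near x, P ord0 i (f y ord0 i).
  by move=> i; apply: (cf i); exact: nP.
apply: filterS => y Py; apply: PB => i j; rewrite (ord1 i); exact: Py.
Qed.

End SmoothOn.

(* [cinv] is total; only its values on [cfun @` cdom] matter. *)
Record chart (R : realType) (M : topologicalType) (n : nat) := Chart {
  cdom : set M;
  cfun :> M -> 'rV[R]_n;
  cinv : 'rV[R]_n -> M;
  cdom_open : open cdom;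
  cimg_open : open (cfun @` cdom);
  cfunK : forall x, cdom x -> cinv (cfun x) = x;
  cfun_continuous : forall x, cdom x -> {for x, continuous cfun};
  cinv_continuous : forall y, (cfun @` cdom) y -> {for y, continuous cinv}
}.

Definition smooth_transition (R : realType) (M : topologicalType) n
    (c d : chart R M n) :=
  forall i, smooth_on (c @` (cdom c `&` cdom d))
                      (fun x => d (cinv c x) ord0 i).

Record manifold (R : realType) (n : nat) := Manifold {
  carrier :> topologicalType;
  manifold_hausdorff : hausdorff_space carrier;
  manifold_second_countable : @second_countable carrier;
  atlas : set (chart R carrier n);
  atlas_cover : forall p, exists2 c, atlas c & cdom c p;
  atlas_smooth : forall c d, atlas c -> atlas d -> smooth_transition c d
}.

Section ProductManifold.
Context {R : realType} {n1 n2 : nat}.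

Section ProductChart.
Context {T1 T2 : topologicalType} (c1 : chart R T1 n1) (c2 : chart R T2 n2).

Let pdom : set (T1 * T2) := cdom c1 `*` cdom c2.
Let pfun (p : T1 * T2) : 'rV[R]_(n1 + n2) := row_mx (c1 p.1) (c2 p.2).
Let pinv (x : 'rV[R]_(n1 + n2)) : T1 * T2 :=
  (cinv c1 (lsubmx x), cinv c2 (rsubmx x)).

Let pdom_open : open pdom.
Proof.
have -> : pdom = fst @^-1` cdom c1 `&` snd @^-1` cdom c2 by [].
by apply: openI; apply: open_comp => [x _|];
  [exact: cvg_fst | exact: cdom_open | exact: cvg_snd | exact: cdom_open].
Qed.

Let pimgE : pfun @` pdom =
  lsubmx @^-1` (c1 @` cdom c1) `&` rsubmx @^-1` (c2 @` cdom c2).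
Proof.
apply/seteqP; split => [_ [[a b] [/= da db] <-]|x [[a da ea] [b db eb]]].
  by rewrite /pfun /=; split => /=; rewrite ?row_mxKl ?row_mxKr; eexists; eauto.
by exists (a, b) => //; rewrite /pfun /= ea eb hsubmxK.
Qed.

Let pimg_open : open (pfun @` pdom).
Proof.
by rewrite pimgE; apply: openI; apply: open_comp => [x _|];
  [exact: continuous_lsubmx | exact: cimg_open
  |exact: continuous_rsubmx | exact: cimg_open].
Qed.

Let pfunK p : pdom p -> pinv (pfun p) = p.
Proof.
case: p => a b [/= da db].
by rewrite /pinv /pfun row_mxKl row_mxKr !cfunK.
Qed.

Let pfun_continuous p : pdom p -> {for p, continuous pfun}.
Proof.
case: p => a b [/= da db]; apply: rV_continuous => i.
case: (split_ordP i) => k ->.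
  under [X in continuous_at _ X]eq_fun do rewrite /pfun row_mxEl.
  apply: (@continuous_comp _ _ _ (fun p : T1 * T2 => c1 p.1)
    (fun x : 'rV[R]_n1 => x ord0 k)); last exact: coord_continuous.
  apply: (@continuous_comp _ _ _ fst); first exact: cvg_fst.
  exact: cfun_continuous.
under [X in continuous_at _ X]eq_fun do rewrite /pfun row_mxEr.
apply: (@continuous_comp _ _ _ (fun p : T1 * T2 => c2 p.2)
  (fun x : 'rV[R]_n2 => x ord0 k)); last exact: coord_continuous.
apply: (@continuous_comp _ _ _ snd); first exact: cvg_snd.
exact: cfun_continuous.
Qed.

Let pinv_continuous y : (pfun @` pdom) y -> {for y, continuous pinv}.
Proof.
rewrite pimgE => -[dl dr].
have cl : continuous_at y (cinv c1 \o lsubmx).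
  apply: continuous_comp; first exact: continuous_lsubmx.
  exact: cinv_continuous.
have cr : continuous_at y (cinv c2 \o rsubmx).
  apply: continuous_comp; first exact: continuous_rsubmx.
  exact: cinv_continuous.
exact: cvg_pair cl cr.
Qed.

Definition prod_chart : chart R (T1 * T2)%type (n1 + n2) :=
  Chart pdom_open pimg_open pfunK pfun_continuous pinv_continuous.

End ProductChart.

Variables (M1 : manifold R n1) (M2 : manifold R n2).

Let prod_hausdorff : hausdorff_space (M1 * M2)%type.
Proof.
move=> [a b] [a' b'] ab; congr (_, _).
  apply: manifold_hausdorff => A B nA nB.
  have [||[x y] [/= Ax Bx]] := ab (fst @^-1` A) (fst @^-1` B).
  - exact: (@cvg_fst _ _ (nbhs a) (nbhs b)).
  - exact: (@cvg_fst _ _ (nbhs a') (nbhs b')).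
  by exists x.
apply: manifold_hausdorff => A B nA nB.
have [||[x y] [/= Ax Bx]] := ab (snd @^-1` A) (snd @^-1` B).
- exact: (@cvg_snd _ _ (nbhs a) (nbhs b)).
- exact: (@cvg_snd _ _ (nbhs a') (nbhs b')).
by exists y.
Qed.

Let prod_second_countable : @second_countable (M1 * M2)%type.
Proof.
have [B1 cB1 [oB1 bB1]] := manifold_second_countable M1.
have [B2 cB2 [oB2 bB2]] := manifold_second_countable M2.
exists ((fun UV => UV.1 `*` UV.2) @` (B1 `*` B2)).
  by apply: sub_countable (card_image_le _ _) _; exact: countableX.
split=> [_ [[U V] [/= BU BV] <-]|[a b] W [[A B] [/= nA nB] ABW]].
  have -> : U `*` V = fst @^-1` U `&` snd @^-1` V by [].
  apply: openI; apply: open_comp => [x _|].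
  - exact: cvg_fst.
  - exact: oB1.
  - exact: cvg_snd.
  - exact: oB2.
have [U [BU Ua] UA] := bB1 a A nA; have [V [BV Vb] VB] := bB2 b B nB.
exists (U `*` V); first by split=> //; exists (U, V).
by move=> [x y] [/= /UA Ax /VB By]; apply: ABW.
Qed.

Let prod_atlas : set (chart R (M1 * M2)%type (n1 + n2)) :=
  [set c | exists c1 c2, [/\ @atlas R n1 M1 c1, @atlas R n2 M2 c2
                           & c = prod_chart c1 c2]].

Let prod_atlas_cover p : exists2 c, prod_atlas c & cdom c p.
Proof.
have [c1 A1 d1] := atlas_cover p.1; have [c2 A2 d2] := atlas_cover p.2.
by exists (prod_chart c1 c2) => //; exists c1, c2.
Qed.

Let prod_atlas_smooth c d :
  prod_atlas c -> prod_atlas d -> smooth_transition c d.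
Proof.
move=> [c1 [c2 [Ac1 Ac2 ->]]] [d1 [d2 [Ad1 Ad2 ->]]] i /=.
case: (split_ordP i) => k ->.
  under [X in smooth_on _ X]eq_fun do rewrite row_mxEl.
  apply: smooth_onS; last first.
    apply: (@smooth_on_linear _ _ _ lsubmx _ _ _
              (atlas_smooth Ac1 Ad1 k)).
    exact: continuous_lsubmx.
  by move=> _ [[a b] [[/= ca cb] [da db]] <-] /=; rewrite row_mxKl; exists a.
under [X in smooth_on _ X]eq_fun do rewrite row_mxEr.
apply: smooth_onS; last first.
  apply: (@smooth_on_linear _ _ _ rsubmx _ _ _ (atlas_smooth Ac2 Ad2 k)).
  exact: continuous_rsubmx.
by move=> _ [[a b] [[/= ca cb] [da db]] <-] /=; rewrite row_mxKr; exists b.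
Qed.

Definition prod_manifold : manifold R (n1 + n2) :=
  Manifold prod_hausdorff prod_second_countable
    prod_atlas_cover prod_atlas_smooth.

End ProductManifold.

(* Carrier of the tangent vectors of [M]: an [lmodType R] for the pointwise
   operations.  The tangent space at [p] is the subset [tangent p]. *)
Notation functional R M := ((M -> R) -> R).

Section Calculus.
Context {R : realType}.

Section OneManifold.
Context {n : nat} {M : manifold R n}.

Definition smooth_fun (f : M -> R) :=
  forall c, @atlas R n M c -> smooth_on (c @` cdom c) (f \o cinv c).

(* Derivations at [p] of the algebra of smooth functions, extended by 0 to
   non-smooth functions so that equality of tangent vectors is equality of
   functionals. *)
Definition tangent (p : M) (v : functional R M) :=
  [/\ forall a f g, smooth_fun f -> smooth_fun g ->
        v (fun x => a * f x + g x) = a * v f + v g,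
      forall f g, smooth_fun f -> smooth_fun g ->
        v (fun x => f x * g x) = v f * g p + f p * v g
    & forall f, ~ smooth_fun f -> v f = 0].

Definition vector_field (X : M -> functional R M) :=
  (forall p, tangent p (X p)) /\
  (forall f, smooth_fun f -> smooth_fun (fun p => X p f)).

Definition fscale (f : M -> R) (X : M -> functional R M) :
  M -> functional R M := fun p => f p *: X p.

Definition bracket (X Y : M -> functional R M) : M -> functional R M :=
  fun p f => X p (fun x => Y x f) - Y p (fun x => X x f).

Definition riemannian_metric (g : M -> functional R M -> functional R M -> R) :=
  [/\ forall p a u v w, tangent p u -> tangent p v -> tangent p w ->
        g p (a *: u + v) w = a * g p u w + g p v w,
      forall p u v, tangent p u -> tangent p v -> g p u v = g p v u,
      forall p u, tangent p u -> u != 0 -> 0 < g p u u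
    & forall X Y, vector_field X -> vector_field Y ->
        smooth_fun (fun p => g p (X p) (Y p))].

Definition levi_civita (g : M -> functional R M -> functional R M -> R)
    (nabla : (M -> functional R M) -> (M -> functional R M) ->
             M -> functional R M) :=
  [/\ forall X Y, vector_field X -> vector_field Y ->
        vector_field (nabla X Y),
      forall f X Y Z, smooth_fun f ->
        vector_field X -> vector_field Y -> vector_field Z ->
        nabla (fscale f X + Y) Z = fscale f (nabla X Z) + nabla Y Z,
      forall f X Y Z, smooth_fun f ->
        vector_field X -> vector_field Y -> vector_field Z ->
        nabla X (fscale f Y + Z) =
          fscale (fun p => X p f) Y + fscale f (nabla X Y) + nabla X Z,
      forall X Y, vector_field X -> vector_field Y ->
        nabla X Y - nabla Y X = bracket X Y
    & forall X Y Z p, vector_field X -> vector_field Y -> vector_field Z ->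
        X p (fun x => g x (Y x) (Z x)) =
          g p (nabla X Y p) (Z p) + g p (Y p) (nabla X Z p)].

Definition tensor11 (F : M -> functional R M -> functional R M) :=
  [/\ forall p v, tangent p v -> tangent p (F p v),
      forall p a u v, tangent p u -> tangent p v ->
        F p (a *: u + v) = a *: F p u + F p v
    & forall X, vector_field X -> vector_field (fun p => F p (X p))].

Definition locally_product_riemannian
    (g : M -> functional R M -> functional R M -> R)
    (nabla : (M -> functional R M) -> (M -> functional R M) ->
             M -> functional R M)
    (F : M -> functional R M -> functional R M) :=
  [/\ [/\ riemannian_metric g, levi_civita g nabla & tensor11 F],
      forall p v, tangent p v -> F p (F p v) = v,
      ~ (forall p v, tangent p v -> F p v = v) /\
      ~ (forall p v, tangent p v -> F p v = - v),
      forall p u v, tangent p u -> tangent p v -> g p (F p u) (F p v) = g p u v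
    & forall U V, vector_field U -> vector_field V ->
        nabla U (fun p => F p (V p)) - (fun p => F p (nabla U V p)) = 0].

End OneManifold.

Definition smooth_map n1 n2 (M : manifold R n1) (N : manifold R n2)
    (j : M -> N) :=
  continuous j /\
  forall c d, @atlas R n1 M c -> @atlas R n2 N d -> forall i,
    smooth_on (c @` (cdom c `&` j @^-1` cdom d))
              (fun x => d (j (cinv c x)) ord0 i).

(* The test for smoothness implements the convention made in [tangent]. *)
Definition differential n1 n2 (M : manifold R n1) (N : manifold R n2)
    (j : M -> N) (v : functional R M) : functional R N :=
  fun f => if `[< smooth_fun f >] then v (f \o j) else 0.

Definition immersion n1 n2 (M : manifold R n1) (N : manifold R n2)
    (j : M -> N) :=
  smooth_map j /\
  forall p u v, tangent p u -> tangent p v ->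
    differential j u = differential j v -> u = v.

Definition isometric_immersion n1 n2 (M : manifold R n1) (N : manifold R n2)
    (g : M -> functional R M -> functional R M -> R)
    (h : N -> functional R N -> functional R N -> R) (j : M -> N) :=
  immersion j /\
  forall p u v, tangent p u -> tangent p v ->
    h (j p) (differential j u) (differential j v) = g p u v.

Definition has_dim (V : lmodType R) (S : set V) (d : nat) :=
  exists e : 'I_d -> V,
    (forall c : 'I_d -> R, \sum_i c i *: e i = 0 -> forall i, c i = 0) /\
    S = [set \sum_i c i *: e i | c in [set: 'I_d -> R]].

Definition sum_set (V : lmodType R) (A B : set V) : set V :=
  [set u + v | u in A & v in B].

Definition constant_rank n (M : manifold R n) (D : M -> set (functional R M)) :=
  exists d, forall p, has_dim (D p) d.

Definition involutive n (M : manifold R n) (D : M -> set (functional R M)) :=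
  forall X Y, vector_field X -> vector_field Y ->
    (forall p, D p (X p)) -> (forall p, D p (Y p)) ->
    forall p, D p (bracket X Y p).

Definition integral_manifold n k (M : manifold R n)
    (D : M -> set (functional R M)) (N : manifold R k) (j : N -> M) :=
  [/\ immersion j, injective j
    & forall x, differential j @` tangent x = D (j x)].

(* Both usual meanings of integrability: closure under the bracket, and an
   integral manifold through every point. *)
Definition integrable_distribution n (M : manifold R n)
    (D : M -> set (functional R M)) :=
  involutive D /\
  forall p, exists k (N : manifold R k) (j : N -> M),
    integral_manifold D j /\ exists x, j x = p.

Section Submanifold.
Context {nb : nat} {Mb : manifold R nb}.
Variables (g : Mb -> functional R Mb -> functional R Mb -> R)
          (F : Mb -> functional R Mb -> functional R Mb).
Context {n : nat} {M : manifold R n}.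
Variable j : M -> Mb.

Definition induced (p : M) (u v : functional R M) : R :=
  g (j p) (differential j u) (differential j v).

(* [T v], seen in the tangent space of [M]; the normal component [N v] lives
   in the tangent space of [Mb]. *)
Definition tan_part (p : M) (v : functional R M) : functional R M :=
  xget 0 [set u | tangent p u /\
    forall w, tangent p w ->
      g (j p) (F (j p) (differential j v) - differential j u)
              (differential j w) = 0].

Definition nor_part (p : M) (v : functional R M) : functional R Mb :=
  F (j p) (differential j v) - differential j (tan_part p v).

Definition anti_invariant_distribution (p : M) : set (functional R M) :=
  [set v | tangent p v /\ tan_part p v = 0].

Definition invariant_distribution (p : M) : set (functional R M) :=
  [set v | tangent p v /\ nor_part p v = 0].

Definition slant_distribution (theta : R) (p : M) : set (functional R M) :=
  [set v | tangent p v /\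
           tan_part p (tan_part p v) = (cos theta ^+ 2) *: v].

Definition orthogonal_at (p : M) (A B : set (functional R M)) :=
  forall u v, A u -> B v -> induced p u v = 0.

Definition invariant_submanifold :=
  immersion j /\
  forall p v, tangent p v ->
    exists2 u, tangent p u & F (j p) (differential j v) = differential j u.

Definition hemi_slant_submanifold (theta : R) :=
  let Dperp := anti_invariant_distribution in
  let Dtheta := slant_distribution theta in
  [/\ immersion j, constant_rank Dperp, constant_rank Dtheta
    & forall p, tangent p = sum_set (Dperp p) (Dtheta p) /\
                orthogonal_at p (Dperp p) (Dtheta p)].

Definition skew_semi_invariant1 (theta : R) :=
  let Dperp := anti_invariant_distribution in
  let DT := invariant_distribution in
  let Dtheta := slant_distribution theta in
  [/\ 0 < cos theta < 1,
      forall p, exists v, [/\ tangent p v, v != 0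
        & tan_part p (tan_part p v) = (cos theta ^+ 2) *: v],
      forall p, tangent p = sum_set (sum_set (Dperp p) (DT p)) (Dtheta p),
      forall p, [/\ orthogonal_at p (Dperp p) (DT p),
                    orthogonal_at p (Dperp p) (Dtheta p)
                  & orthogonal_at p (DT p) (Dtheta p)]
    & [/\ constant_rank Dperp, constant_rank DT & constant_rank Dtheta]].

Definition proper_skew_semi_invariant1 (theta : R) :=
  [/\ skew_semi_invariant1 theta,
      forall p, anti_invariant_distribution p <> [set 0]
    & forall p, invariant_distribution p <> [set 0]].

End Submanifold.

Definition warped_metric n1 n2 (M1 : manifold R n1) (M2 : manifold R n2)
    (g1 : M1 -> functional R M1 -> functional R M1 -> R) (f : M1 -> R)
    (g2 : M2 -> functional R M2 -> functional R M2 -> R)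
    (p : prod_manifold M1 M2) (u v : functional R (prod_manifold M1 M2)) : R :=
  g1 p.1 (differential (fst : prod_manifold M1 M2 -> M1) u)
         (differential (fst : prod_manifold M1 M2 -> M1) v) +
  f p.1 ^+ 2 *
  g2 p.2 (differential (snd : prod_manifold M1 M2 -> M2) u)
         (differential (snd : prod_manifold M1 M2 -> M2) v).

Definition slice1 n1 n2 (M1 : manifold R n1) (M2 : manifold R n2) (p2 : M2) :
  M1 -> prod_manifold M1 M2 := fun p1 => (p1, p2).

Definition slice2 n1 n2 (M1 : manifold R n1) (M2 : manifold R n2) (p1 : M1) :
  M2 -> prod_manifold M1 M2 := fun p2 => (p1, p2).

(* [M1 x_f MT], immersed in [Mb] by [j]; the factors are viewed as submanifolds
   of [Mb] through the slices of the product. *)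
Definition warped_product_skew_semi_invariant1 nb (Mb : manifold R nb)
    (g : Mb -> functional R Mb -> functional R Mb -> R)
    (F : Mb -> functional R Mb -> functional R Mb)
    n1 n2 (M1 : manifold R n1) (MT : manifold R n2)
    (g1 : M1 -> functional R M1 -> functional R M1 -> R) (f : M1 -> R)
    (gT : MT -> functional R MT -> functional R MT -> R)
    (j : prod_manifold M1 MT -> Mb) (theta : R) :=
  [/\ [/\ riemannian_metric g1, riemannian_metric gT,
          smooth_fun f & forall p1, 0 < f p1],
      isometric_immersion (warped_metric g1 f gT) g j,
      proper_skew_semi_invariant1 g F j theta,
      (forall p2 : MT, hemi_slant_submanifold g F (j \o slice1 p2) theta) /\
      (forall (p1 : M1) (p2 : MT),
         differential (slice1 p2 : M1 -> prod_manifold M1 MT) @` tangent p1 =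
         sum_set (anti_invariant_distribution g F j (p1, p2))
                 (slant_distribution g F j theta (p1, p2)))
    & (forall p1 : M1, invariant_submanifold F (j \o slice2 p1)) /\
      (forall (p1 : M1) (p2 : MT),
         differential (slice2 p1 : MT -> prod_manifold M1 MT) @` tangent p2 =
         invariant_distribution g F j (p1, p2))].

End Calculus.

(* Main.v *)
(* The distribution [D^T] is tangent to the second factor of the product, and
   consists exactly of the tangent vectors killing every smooth function pulled
   back from [M1]: the decomposition of the tangent space of a skew
   semi-invariant submanifold splits any tangent vector into a part coming from
   [M1] and one coming from [MT], and the former is detected by such functions.
   A bracket of two fields killing these functions kills them too, and the
   leaves [{p1} * MT] are integral manifolds. *)
Require Import Defs.
From mathcomp Require Import all_boot all_order all_algebra.
From mathcomp Require Import all_classical all_reals all_analysis.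
From mathcomp Require Import ring.

Section ProductFoliation.

Import Order.TTheory GRing.Theory Num.Theory.
Import numFieldNormedType.Exports.
Local Open Scope classical_set_scope.
Local Open Scope ring_scope.

Context {R : realType}.

Section CkOn.
Context {n : nat} {A : set 'rV[R]_n}.
Implicit Types f g : 'rV[R]_n -> R.

(** Since [A] is open, agreement on [A] is agreement near each of its points, so continuity and all
    directional derivatives transfer. This lets the sum and product rules, valid only on [A],
    rewrite derivatives below. *)
Lemma Ck_on_eq k f g : open A -> (forall x, A x -> f x = g x) ->
  Ck_on k A f -> Ck_on k A g.
Proof.
move=> oA; elim: k f g => [|k IH] f g fg.
all: have nfg x : A x -> \near x, f x = g x
  by move=> Ax; have := open_nbhs_nbhs (conj oA Ax); apply: filterS.
all: have cg : (forall x, A x -> {for x, continuous f}) ->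
    forall x, A x -> {for x, continuous g}
  by move=> cf x Ax; rewrite /prop_for /continuous_at -(fg x Ax);
     exact: cvg_trans (near_eq_cvg (nfg x Ax)) (cf x Ax).
  by move=> [cf _]; split=> //; exact: cg.
move=> [cf df]; split; first exact: cg.
move=> v; have [d Cd] := df v; split.
  by move=> x Ax; apply: near_eq_derivable (d x Ax); exact: nfg.
apply: IH Cd => x Ax; apply: near_eq_derive; exact: nfg.
Qed.

Lemma Ck_onW k f : Ck_on k.+1 A f -> Ck_on k A f.
Proof.
elim: k f => [|k IH] f [cf df]; split=> // v.
by have [d Cd] := df v; split=> //; exact: IH.
Qed.

Lemma Ck_onD k f g : open A -> Ck_on k A f -> Ck_on k A g ->
  Ck_on k A (fun x => f x + g x).
Proof.
move=> oA; elim: k f g => [|k IH] f g [cf df] [cg dg]; split=> //.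
- by move=> x Ax; exact: cvgD (cf x Ax) (cg x Ax).
- by move=> x Ax; exact: cvgD (cf x Ax) (cg x Ax).
move=> v; have [d Cd] := df v; have [e Ce] := dg v; split.
  by move=> x Ax; apply: derivableD; [exact: d | exact: e].
apply: (Ck_on_eq _ _ _ oA _ (IH _ _ Cd Ce)) => x Ax.
by rewrite -deriveD //; [exact: d | exact: e].
Qed.

(** Induction through the Leibniz rule; [Ck_onW] lowers the order of the undifferentiated factor to
    match that of the differentiated one. *)
Lemma Ck_onM k f g : open A -> Ck_on k A f -> Ck_on k A g ->
  Ck_on k A (fun x => f x * g x).
Proof.
move=> oA; elim: k f g => [|k IH] f g Cf Cg.
all: have cM x : A x -> {for x, continuous (fun x => f x * g x)}
  by move=> Ax; exact: cvgM (Cf.1 x Ax) (Cg.1 x Ax).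
  by [].
split=> // v; have [d Cd] := Cf.2 v; have [e Ce] := Cg.2 v; split.
  by move=> x Ax; apply: derivableM; [exact: d | exact: e].
apply: (Ck_on_eq _ _ _ oA _ (Ck_onD k _ _ oA
  (IH _ _ (Ck_onW _ _ Cf) Ce) (IH _ _ Cd (Ck_onW _ _ Cg)))) => x Ax.
rewrite [X in _ + X]mulrC; exact: esym (deriveM (d x Ax) (e x Ax)).
Qed.

Lemma smooth_on_cst (a : R) : smooth_on A (fun=> a).
Proof.
move=> k; elim: k a => [|k IH] a; split=> //.
- by move=> x _; exact: cst_continuous.
- by move=> x _; exact: cst_continuous.
move=> v; split; first by move=> x _; exact: derivable_cst.
by under eq_fun do rewrite derive_cst; exact: IH.
Qed.

End CkOn.

Section Bracket.
Context {n : nat} {M : manifold R n}.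

Lemma smooth_cst (a : R) : smooth_fun ((fun=> a) : M -> R).
Proof. by move=> c _; exact: smooth_on_cst. Qed.

Lemma smooth_funM (f g : M -> R) :
  smooth_fun f -> smooth_fun g -> smooth_fun (fun x => f x * g x).
Proof.
move=> sf sg c Ac k.
by apply: (Ck_onM k (f \o cinv c) (g \o cinv c));
  [exact: cimg_open | exact: sf | exact: sg].
Qed.

(** The Leibniz rule on [1 * 1] gives [v 1 = v 1 + v 1], hence [v 1 = 0]; linearity then reaches
    every constant. *)
Lemma tangent_cst {p : M} {v} (a : R) : tangent p v -> v (fun=> a) = 0.
Proof.
case=> vL vM _.
have v1 : v (fun=> 1) = 0.
  have := vM _ _ (smooth_cst 1) (smooth_cst 1).
  by rewrite !mulr1 mul1r -[LHS]addr0 => /addrI.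
have v0 : v (fun=> 0) = 0.
  have := vL 1 _ _ (smooth_cst 0) (smooth_cst 0).
  by rewrite mulr0 addr0 mul1r -[LHS]addr0 => /addrI.
have := vL a _ _ (smooth_cst 1) (smooth_cst 0).
by rewrite mulr1 addr0 v1 v0 mulr0 addr0.
Qed.

Lemma tangentD {p : M} {v} (f g : M -> R) : tangent p v ->
  smooth_fun f -> smooth_fun g -> v (fun x => f x + g x) = v f + v g.
Proof.
case=> vL _ _ sf sg; rewrite -[v f]mul1r -vL//.
by congr (v _); apply/funext => x; rewrite mul1r.
Qed.

(** For the Leibniz rule, the mixed terms [X f * Y g] and [Y f * X g] occur in both iterated
    derivatives of [f * g] and cancel in the difference. *)
Lemma tangent_bracket (X Y : M -> functional R M) p :
  vector_field X -> vector_field Y -> tangent p (bracket X Y p).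
Proof.
move=> [tX sX] [tY sY]; have [XL XM X0] := tX p; have [YL YM Y0] := tY p.
split=> [a f g sf sg|f g sf sg|f nf]; rewrite /bracket.
- have -> : (fun x => Y x (fun x => a * f x + g x)) =
            (fun x => a * Y x f + Y x g).
    by apply/funext => x; have [-> //] := tY x.
  have -> : (fun x => X x (fun x => a * f x + g x)) =
            (fun x => a * X x f + X x g).
    by apply/funext => x; have [-> //] := tX x.
  by rewrite XL ?YL; [ring|exact: sX..|exact: sY|exact: sY].
- have -> : (fun x => Y x (fun x => f x * g x)) =
            (fun x => Y x f * g x + f x * Y x g).
    by apply/funext => x; have [_ -> //] := tY x.
  have -> : (fun x => X x (fun x => f x * g x)) =
            (fun x => X x f * g x + f x * X x g).
    by apply/funext => x; have [_ -> //] := tX x.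
  have [sXf sXg] := (sX f sf, sX g sg); have [sYf sYg] := (sY f sf, sY g sg).
  rewrite (tangentD _ _ (tX p)) ?(tangentD _ _ (tY p)) ?XM ?YM//; try exact: smooth_funM.
  ring.
(* On a non-smooth [f] both inner functions are identically 0 by the convention in [tangent], so the
   outer vectors act on a constant. *)
- under eq_fun do rewrite (let: And3 _ _ h := tY _ in h f nf).
  under [in X in _ - X]eq_fun do rewrite (let: And3 _ _ h := tX _ in h f nf).
  by rewrite (tangent_cst _ (tX p)) (tangent_cst _ (tY p)) subr0.
Qed.

End Bracket.

Section Slices.
Context {n1 n2 : nat} {M1 : manifold R n1} {M2 : manifold R n2}.

Notation P := (prod_manifold M1 M2).

(** In a product chart the pullback is the local expression of [h] composed with the linear
    projection [lsubmx]. *)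
Lemma smooth_fun_fst (h : M1 -> R) :
  smooth_fun h -> smooth_fun (fun p : P => h p.1).
Proof.
move=> sh _ [c1 [c2 [A1 A2 ->]]].
apply: smooth_onS; last first.
  apply: (@smooth_on_linear _ _ _ lsubmx _ _ _ (sh _ A1)).
  exact: continuous_lsubmx.
by move=> _ [[a b] [/= da db] <-] /=; rewrite row_mxKl; exists a.
Qed.

Lemma smooth_fun_snd (h : M2 -> R) :
  smooth_fun h -> smooth_fun (fun p : P => h p.2).
Proof.
move=> sh _ [c1 [c2 [A1 A2 ->]]].
apply: smooth_onS; last first.
  apply: (@smooth_on_linear _ _ _ rsubmx _ _ _ (sh _ A2)).
  exact: continuous_rsubmx.
by move=> _ [[a b] [/= da db] <-] /=; rewrite row_mxKr; exists b.
Qed.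

(** In a product chart the first block of coordinates is constant and the second is a transition map
    of [M2]. *)
Lemma smooth_map_slice2 (p1 : M1) : smooth_map (slice2 p1 : M2 -> P).
Proof.
split=> [p2|c _ Ac [c1 [c2 [A1 A2 ->]]] i].
  by apply: cvg_pair; [exact: cvg_cst | exact: cvg_id].
case: (split_ordP i) => k ->.
  have -> : (fun x => prod_chart c1 c2 (slice2 p1 (cinv c x)) ord0 (lshift n2 k))
    = (fun=> c1 p1 ord0 k) by apply/funext => x; rewrite /= row_mxEl.
  exact: smooth_on_cst.
have -> : (fun x => prod_chart c1 c2 (slice2 p1 (cinv c x)) ord0 (rshift n1 k))
  = (fun x => c2 (cinv c x) ord0 k) by apply/funext => x; rewrite /= row_mxEr.
apply: smooth_onS (atlas_smooth Ac A2 k).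
by move=> _ [x [cx [_ /= dx]] <-]; exists x.
Qed.

(** The second projection is a left inverse of the slice, so a vector is recovered by testing its
    image on functions pulled back from [M2]. *)
Lemma immersion_slice2 (p1 : M1) : immersion (slice2 p1 : M2 -> P).
Proof.
split; first exact: smooth_map_slice2.
move=> p2 u v [_ _ u0] [_ _ v0] uv; apply/funext => h.
have [sh|nh] := pselect (smooth_fun h); last by rewrite u0 ?v0.
have := congr1 (fun w => w (fun p : P => h p.2)) uv.
by rewrite /differential; case: asboolP => // -[]; exact: smooth_fun_snd.
Qed.

Lemma slice1_fst (p2 : M2) {p1 : M1} {u} h : tangent p1 u -> smooth_fun h ->
  differential (slice1 p2 : M1 -> P) u (fun p => h p.1) = u h.
Proof.
move=> tu sh.
by rewrite /differential; case: asboolP => // -[]; exact: smooth_fun_fst.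
Qed.

Lemma slice2_fst (p1 : M1) {p2 : M2} {v} h : tangent p2 v ->
  differential (slice2 p1 : M2 -> P) v (fun p => h p.1) = 0.
Proof.
by move=> tv; rewrite /differential; case: ifP => // _; exact: (tangent_cst (h p1) tv).
Qed.

Context (D : P -> set (functional R P)).
Hypothesis D_slice2 : forall p1 p2,
  differential (slice2 p1 : M2 -> P) @` tangent p2 = D (p1, p2).

Lemma integrable_slice2 :
  (forall p1 p2, tangent ((p1, p2) : P) `<=`
     sum_set (differential (slice1 p2 : M1 -> P) @` tangent p1) (D (p1, p2))) ->
  integrable_distribution D.
Proof.
move=> split_tangent; split; last first.
  move=> [p1 p2]; exists n2, M2, (slice2 p1); split; last by exists p2.
  split; [exact: immersion_slice2 | by move=> x y [] | by move=> x; exact: D_slice2].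
move=> X Y vX vY DX DY [p1 p2].
(* This is an equality of functions, not just of values at one point, so that the outer field of the
   bracket can be applied to it. *)
have D_fst Z : (forall p, D p (Z p)) -> forall h,
    (fun p => Z p (fun q : P => h q.1)) = fun=> 0.
  move=> DZ h; apply/funext => -[a b].
  by have := DZ (a, b); rewrite -D_slice2 => -[v tv <-]; exact: (slice2_fst a h tv).
have tXY := tangent_bracket X Y (p1, p2) vX vY.
have [_ [u tu <-] [w Dw uw]] := split_tangent _ _ _ tXY.
(* Evaluated on a pullback from [M1], the bracket and [w] both give 0, which leaves [u h = 0]: the
   bracket has no component along [M1]. *)
have u0 : u = 0.
  apply/funext => h; have [sh|nh] := pselect (smooth_fun h); last first.
    by case: tu => _ _ /(_ h nh).
  have := congr1 (fun v => v (fun q : P => h q.1)) uw.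
  rewrite /bracket (D_fst X DX) (D_fst Y DY).
  rewrite (tangent_cst 0 (vX.1 _)) (tangent_cst 0 (vY.1 _)) subr0.
  move: Dw; rewrite -D_slice2 => -[v tv <-].
  by rewrite fctE (slice1_fst _ _ tu sh) (slice2_fst _ _ tv) addr0.
rewrite -uw u0; suff -> : differential (slice1 p2 : M1 -> P) 0 = 0 by rewrite add0r.
by apply/funext => h; rewrite /differential; case: ifP.
Qed.

End Slices.

End ProductFoliation.

Theorem theorem5p3 (R : realType) (q m : nat)
    (Mb : manifold R (2 * q + m))
    (g : Mb -> functional R Mb -> functional R Mb -> R)
    (nabla : (Mb -> functional R Mb) -> (Mb -> functional R Mb) ->
             Mb -> functional R Mb)
    (F : Mb -> functional R Mb -> functional R Mb)
    (M1 : manifold R q) (MT : manifold R m)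
    (g1 : M1 -> functional R M1 -> functional R M1 -> R)
    (f : M1 -> R)
    (gT : MT -> functional R MT -> functional R MT -> R)
    (j : prod_manifold M1 MT -> Mb) (theta : R) :
  locally_product_riemannian g nabla F ->
  warped_product_skew_semi_invariant1 g F g1 f gT j theta ->
  integrable_distribution (invariant_distribution g F j).
Proof.
move=> _ [_ _ [[_ _ tangentE _ _] _ _] [_ slice1E] [_ slice2E]].
apply: integrable_slice2 => // p1 p2 v.
rewrite tangentE slice1E => -[_ [u Du [w Dw <-]] [z Dz <-]].
(* Regroups anti-invariant + invariant + slant as (anti-invariant + slant) + invariant; the
   bracketed sum is the space tangent to the [M1] slice. *)
exists (u + z)%R; first by exists u => //; exists z.
by exists w => //; rewrite GRing.addrAC.
Qed.
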